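(* Let $(\lambda_n)_{n\ge 1}$ be a positive sequence with $\sum_{n=1}^\infty\lambda_n<+\infty$, and let $\Lambda_n=\sum_{k=n}^{\infty}\lambda_k$. Let $p\ne 0$ be fixed and let $(a_n)_{n\ge1}$ be a sequence with $a_n>0$ for all $n$. Let $L$ be a real number satisfying $L<p$ when $p>0$ and $L>p$ when $p<0$. When $p<0$, suppose moreover that $$\lim_{n\to\infty}\frac{\Lambda_{n+1}}{\lambda_n}\Big(\frac{\sum_{k=n+1}^{\infty}\lambda_ka_k}{\Lambda_{n+1}}\Big)^p=0 .$$ (i) If $p>1$ or $p<0$, and if for all $n\ge 1$ (with the convention $\Lambda_0/\lambda_0=1$) $$\frac{\Lambda_{n-1}}{\lambda_{n-1}}\ \le\ \frac{\Lambda_n}{\lambda_n}\Big(1-\frac{L\lambda_n}{p\Lambda_n}\Big)^{1-p}+\frac{L}{p},$$ then $$\sum_{n=1}^{\infty}\Big(\sum_{k=n}^{\infty}\frac{\lambda_ka_k}{\Lambda_n}\Big)^p\ \le\ \Big(\frac{p}{p-L}\Big)^p\sum_{n=1}^{\infty}a_n^p .$$ (ii) If $0<p<1$, and if for all $n\ge 1$ (with the convention $\Lambda_0/\lambda_0=1$) $$\frac{\Lambda_{n-1}}{\lambda_{n-1}}\ \ge\ \frac{\Lambda_n}{\lambda_n}\Big(1-\frac{L\lambda_n}{p\Lambda_n}\Big)^{1-p}+\frac{L}{p},$$ then $$\sum_{n=1}^{\infty}\Big(\sum_{k=n}^{\infty}\frac{\lambda_ka_k}{\Lambda_n}\Big)^p\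 \ge\ \Big(\frac{p}{p-L}\Big)^p\sum_{n=1}^{\infty}a_n^p .$$
   Context: The symbol $\Lambda_0/\lambda_0$ is a formal quantity set equal to $1$; it is used only in the condition for $n=1$. All sums have nonnegative terms and take values in $[0,+\infty]$, with $(+\infty)^s=+\infty$ for $s>0$ and $(+\infty)^s=0$ for $s<0$. *)

(* Defs.v *)
From mathcomp Require Import all_boot all_order all_algebra.
From mathcomp Require Import all_classical all_reals all_analysis.
Set Implicit Arguments.
Unset Strict Implicit.
Unset Printing Implicit Defensive.
Import Order.TTheory GRing.Theory Num.Theory.
Import numFieldNormedType.Exports.

Local Open Scope classical_set_scope.
Local Open Scope ring_scope.

(* Sequences are indexed by n >= 1: they are functions on nat whose value at 0
   is never used. *)

(* Power of an element of [0, +oo] with a real exponent.  The library's poweR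
   is not used because there +oo `^ s = +oo also for s < 0, whereas here
   (+oo)^s = 0 for s < 0. *)
Definition epow (R : realType) (x : \bar R) (s : R) : \bar R :=
  match x with
  | r%:E => (r `^ s)%:E
  | +oo%E => if 0 < s then +oo%E else if s < 0 then 0%E else 1%E
  | -oo%E => 0%E
  end.

(* Lambda_n, as a real number; meaningful when lambda is summable. *)
Definition tail (R : realType) (lam : nat -> R) (n : nat) : R :=
  fine (\sum_(n <= k <oo) (lam k)%:E)%E.

(* Lambda_n / lambda_n, with the convention Lambda_0 / lambda_0 = 1. *)
Definition tail_ratio (R : realType) (lam : nat -> R) (n : nat) : R :=
  if n is 0%N then 1 else tail lam n / lam n.

(* Main.v *)
Require Import Defs.
From mathcomp Require Import all_boot all_order all_algebra.
From mathcomp Require Import all_classical all_reals all_analysis.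
From mathcomp Require Import ring lra.
Import Order.TTheory GRing.Theory Num.Theory.
Import numFieldNormedType.Exports.
Local Open Scope classical_set_scope.
Local Open Scope ring_scope.

(* Write A_n for the tail means, r_n = Lambda_n / lambda_n and c = L / p, so that
   r_n A_n = a_n + (r_n - 1) A_{n+1}.  Applying Jensen's inequality for t^p to
   this splitting with weights 1 - c and r_n - 1 bounds
   r_n (1 - c / r_n)^(1-p) A_n^p by (1 - c)^(1-p) a_n^p + (r_n - 1) A_{n+1}^p
   (from below if 0 < p < 1).  The condition on the weights replaces the left
   factor by r_{n-1} - c, after which the sum over n <= N telescopes up to the
   boundary term (r_N - 1) A_{N+1}^p.  That term tends to 0 by hypothesis if p < 0,
   has the right sign if 0 < p < 1, and vanishes if p > 1 once the sequence a is
   truncated after N. *)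

(** * Bernoulli, tangent-line and two-point Jensen inequalities for real powers *)

Lemma powR_bernoulli_gt1 (R : realType) (p t : R) : 1 < p -> 0 <= t ->
  1 + p * (t - 1) <= t `^ p.
Proof.
move=> p1 t0.
have p0 : 0 < p by lra.
have q0 : 0 < (1 - p^-1)^-1 by rewrite invr_gt0 subr_gt0 invf_lt1.
(* Young's inequality for [t] and 1, with [p] and its conjugate exponent. *)
have := @conjugate_powR R t 1 p (1 - p^-1)^-1 t0 ler01 p0 q0.
rewrite invrK powR1 mulr1 mul1r => /(_ ltac:(by rewrite addrC subrK)) h.
have : p * t <= p * (t `^ p / p + (1 - p^-1)) by rewrite ler_pM2l.
rewrite mulrDr mulrCA mulfV ?gt_eqF// mulr1 mulrBr mulr1 mulfV ?gt_eqF//.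
lra.
Qed.

(* The factor [p * (p - 1)] has the sign of the second derivative of [t `^ p], so
   that the convex and concave cases are treated at once. *)
Lemma powR_bernoulli (R : realType) (p t : R) : 0 <= t -> (0 < p \/ 0 < t) ->
  p * (p - 1) * (1 + p * (t - 1)) <= p * (p - 1) * t `^ p.
Proof.
move=> t0 pt.
have [p0|p0|->] := ltgtP p 0; last by rewrite !mul0r.
- have {pt t0}t0 : 0 < t by case: pt => // /(lt_trans p0); rewrite ltxx.
  rewrite ler_pM2l; last by nra.
  (* For [p < 0] the exponent [1 - p] exceeds 1: use the previous case at [t^-1], then multiply by
     [t]. *)
  have := @powR_bernoulli_gt1 R (1 - p) t^-1 ltac:(lra) ltac:(by rewrite invr_ge0 ltW).
  have -> : t^-1 `^ (1 - p) = t `^ p / t.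
    rewrite -(powR_inv1 (ltW t0)) -powRrM -powRD; last by rewrite (gt_eqF t0) implybT.
    by congr (_ `^ _); ring.
  move=> h.
  have := ler_wpM2l (ltW t0) h.
  rewrite (mulrC t (_ / _)) divfK ?gt_eqF//.
  have -> : t * (1 + (1 - p) * (t^-1 - 1)) = t + (1 - p) * (t * t^-1 - t) by ring.
  by rewrite mulfV ?gt_eqF//; lra.
- have [p1|p1|->] := ltgtP p 1; last by rewrite subrr mulr0 !mul0r.
  + rewrite ler_nM2l; last by nra.
    (* For [0 < p < 1] the power is undone: the exponent is [p^-1], the point is the [p]-th power of
       [t], and the inequality reverses. *)
    have := @powR_bernoulli_gt1 R p^-1 (t `^ p) ltac:(by rewrite invf_gt1) (powR_ge0 _ _).
    rewrite -powRrM mulfV ?gt_eqF// powRr1// => h.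
    have := ler_wpM2l (ltW p0) h.
    by rewrite mulrDr mulrA mulfV ?gt_eqF//; lra.
  + by rewrite ler_pM2l ?powR_bernoulli_gt1//; nra.
Qed.

Lemma powR_tangent (R : realType) (p T z : R) : 0 < T -> 0 <= z ->
  (0 < p \/ 0 < z) ->
  p * (p - 1) * ((1 + p * (z / T - 1)) * T `^ p) <= p * (p - 1) * z `^ p.
Proof.
move=> T0 z0 pz; rewrite -[z in leRHS](divfK (lt0r_neq0 T0)).
rewrite [in leRHS]powRM ?divr_ge0 ?(ltW T0)// [leLHS]mulrA [leRHS]mulrA.
rewrite ler_wpM2r ?powR_ge0//.
apply: powR_bernoulli; first by rewrite divr_ge0 ?(ltW T0).
by case: pz => ?; [left|right; rewrite divr_gt0].
Qed.

(** The tangent inequalities for [x] and [y] at their weighted mean [T] are added with weights [u]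
    and [v]; the linear terms cancel by the choice of [T]. *)
Lemma powR_jensen2 (R : realType) (p u v x y : R) : 0 < u -> 0 < v -> 0 < x ->
  0 <= y -> (0 < p \/ 0 < y) ->
  p * (p - 1) * ((u + v) * ((u * x + v * y) / (u + v)) `^ p) <=
  p * (p - 1) * (u * x `^ p + v * y `^ p).
Proof.
move=> u0 v0 x0 y0 py.
have uv0 : 0 < u + v by rewrite addr_gt0.
have : 0 < (u * x + v * y) / (u + v).
  by rewrite divr_gt0// ltr_pwDl ?mulr_gt0 ?mulr_ge0// ltW.
have : u * x + v * y = (u + v) * ((u * x + v * y) / (u + v)).
  by rewrite [RHS]mulrC divfK // gt_eqF.
move: (_ / (u + v)) => T e T0.
have := lerD
  (ler_wpM2l (ltW u0) (powR_tangent R p _ _ T0 (ltW x0) (or_intror x0)))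
  (ler_wpM2l (ltW v0) (powR_tangent R p _ _ T0 y0 py)).
have -> : p * (p - 1) * (u * x `^ p + v * y `^ p) =
    u * (p * (p - 1) * x `^ p) + v * (p * (p - 1) * y `^ p) by ring.
move=> h; apply: (le_trans _ h); rewrite le_eqVlt; apply/orP; left; apply/eqP.
have slope0 : u * (x / T - 1) + v * (y / T - 1) = 0.
  have -> : u * (x / T - 1) + v * (y / T - 1) = (u * x + v * y) / T - (u + v) by ring.
  by rewrite e mulfK ?gt_eqF// subrr.
transitivity (p * (p - 1) * T `^ p * ((u + v) + p * (u * (x / T - 1) + v * (y / T - 1)))).
  by rewrite slope0; ring.
by ring.
Qed.

(** * The one-step inequality and its telescoping *)

Lemma copson_step (R : realType) (p c r a A A' : R) : c < 1 -> 1 < r -> 0 < a ->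
  0 <= A' -> (0 < p \/ 0 < A') -> r * A = a + (r - 1) * A' ->
  p * (p - 1) * (r * (1 - c / r) `^ (1 - p) * A `^ p) <=
  p * (p - 1) * ((1 - c) `^ (1 - p) * a `^ p + (r - 1) * A' `^ p).
Proof.
move=> c1 r1 a0 A'0 pA' rA.
have c0 : 0 < 1 - c by lra.
have r0 : 0 < r by lra.
have rc0 : 0 < 1 - c / r.
  by rewrite subr_gt0 ltr_pdivrMr// mul1r; lra.
have A0 : 0 < A.
  rewrite -(pmulr_rgt0 _ r0) rA ltr_pwDl// mulr_ge0//; lra.
(* The point [a / (1 - c)] with weight [1 - c] contributes exactly [a], so the weighted sum is
   [r * A], and the total weight is [r - c = r * (1 - c / r)]. *)
have := @powR_jensen2 R p (1 - c) (r - 1) (a / (1 - c)) A' c0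
  ltac:(lra) (divr_gt0 a0 c0) A'0 pA'.
rewrite [(1 - c) * (a / _)]mulrC divfK ?gt_eqF// -rA.
have -> : 1 - c + (r - 1) = r * (1 - c / r).
  by rewrite mulrBr mulr1 mulrCA mulfV ?gt_eqF//; ring.
rewrite -mulf_div mulfV ?gt_eqF// mul1r.
have homogeneity x y : 0 < x -> 0 <= y ->
    x * (y / x) `^ p = x `^ (1 - p) * y `^ p.
  move=> x0 y0; rewrite powRM ?invr_ge0 ?(ltW x0)// powRD ?(gt_eqF x0) ?implybT//.
  rewrite powRr1 ?(ltW x0)// -[in LHS](powR_inv1 (ltW x0)) -powRrM mulN1r.
  by ring.
by rewrite -(mulrA r) homogeneity ?(ltW A0)// homogeneity ?(ltW a0)// -(mulrA r).
Qed.

Lemma copson_partial_sum (R : realType) (p c : R) (r a A : nat -> R) (N : nat) :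
  c < 1 -> r 0%N = 1 ->
  (forall n, (1 <= n <= N)%N -> [/\ 1 < r n, 0 < a n, 0 <= A n.+1,
     0 < p \/ 0 < A n.+1 & r n * A n = a n + (r n - 1) * A n.+1]) ->
  (forall n, (1 <= n <= N)%N -> p * (p - 1) * r n.-1 <=
     p * (p - 1) * (r n * (1 - c / r n) `^ (1 - p) + c)) ->
  p * (p - 1) * (\sum_(1 <= n < N.+1) A n `^ p) <=
  p * (p - 1) * ((1 - c)^-1 `^ p * (\sum_(1 <= n < N.+1) a n `^ p) +
                 (r N - 1) * A N.+1 `^ p / (1 - c)).
Proof.
move=> c1 r0 hA hr; have c0 : 0 < 1 - c by lra.
(* Multiplying by [1 - c > 0] clears the denominator and turns the constant into the power [1 - p]
   of [1 - c], as in the one-step inequality. *)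
suff : p * (p - 1) * ((1 - c) * \sum_(1 <= n < N.+1) A n `^ p) <=
    p * (p - 1) * ((1 - c) `^ (1 - p) * (\sum_(1 <= n < N.+1) a n `^ p) +
                 (r N - 1) * A N.+1 `^ p).
  move=> h; rewrite -(ler_pM2l c0) ![(1 - c) * (_ * _)]mulrCA (le_trans h)//.
  rewrite [(1 - c) * _]mulrDr mulrA [_ * (_ / (1 - c))]mulrCA mulfV ?gt_eqF// mulr1.
  rewrite -(powR_inv1 (ltW c0)) -powRrM mulN1r.
  rewrite [in leLHS]powRD; last by rewrite (gt_eqF c0) implybT.
  by rewrite powRr1 ?(ltW c0)// mulrA.
elim: N hA hr => [_ _|N IH hA hr].
  (* For the empty sum the boundary term carries the factor [r 0 - 1], which is zero by the
     convention on the ratio at 0. *)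
  by rewrite !big_geq// r0 subrr mul0r addr0 !mulr0.
have lt_N n : (1 <= n <= N)%N -> (1 <= n <= N.+1)%N.
  by case/andP=> -> /leqW.
have {}IH := IH (fun n hn => hA n (lt_N n hn)) (fun n hn => hr n (lt_N n hn)).
have [r1 a0 A0 pA rA] := hA N.+1 (leqnn _).
have := @copson_step R p c _ _ _ _ c1 r1 a0 A0 pA rA.
(* The old boundary coefficient [r N - 1] and the new summand's [1 - c] add up to [r N - c], which
   the weight condition compares with the left factor of the one-step inequality. *)
have := ler_wpM2r (powR_ge0 (A N.+1) p) (hr N.+1 (leqnn _)) => /=.
rewrite !(big_nat_recr N.+1)//=.
set k := p * (p - 1).
move: IH; rewrite -/k.
set s1 := \sum_(_ <= _ < _) _; set s2 := \sum_(_ <= _ < _) _.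
lra.
Qed.

(** * Nonnegative series, their tails, and limits of powers *)

Lemma nneseries_le (R : realType) (u : nat -> \bar R) (m : nat) (x : \bar R) :
  (forall n, (m <= n)%N -> 0 <= u n)%E ->
  (forall N, (m <= N)%N -> \sum_(m <= n < N) u n <= x)%E ->
  (\sum_(m <= n <oo) u n <= x)%E.
Proof.
move=> u0 ux; apply: lime_le; first by apply: is_cvg_nneseries => n mn _; exact: u0.
by near=> N; apply: ux; near: N; exact: nbhs_infty_ge.
Unshelve. all: by end_near. Qed.

Lemma nneseries_divr (R : realType) (f : nat -> R) (m : nat) (d : R) :
  (forall n, (m <= n)%N -> 0 <= f n) ->
  (\sum_(m <= n <oo) (f n / d)%:E = d^-1%:E * \sum_(m <= n <oo) (f n)%:E)%E.
Proof.
move=> f0; rewrite -limeMl//; last first.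
  by apply: is_cvg_nneseries => n mn _; rewrite lee_fin f0.
apply/congr_lim/funext => N /=.
by rewrite !sumEFin -EFinM mulrC mulr_suml.
Qed.

Section tail.
Context (R : realType) (f : nat -> R) (m : nat).
Hypothesis f_gt0 : forall n, (m <= n)%N -> 0 < f n.

Let f_ge0 n : (m <= n)%N -> (0 <= (f n)%:E)%E.
Proof. by move=> mn; rewrite lee_fin ltW// f_gt0. Qed.

Lemma nneseries_tail_pinfty n : (m <= n)%N ->
  (\sum_(m <= k <oo) (f k)%:E = +oo -> \sum_(n <= k <oo) (f k)%:E = +oo)%E.
Proof.
move=> mn; rewrite (nneseries_split m (n - m) f_ge0) subnKC// sumEFin.
by case: (\sum_(n <= k <oo) (f k)%:E)%E.
Qed.

Hypothesis f_sum : (\sum_(m <= k <oo) (f k)%:E < +oo)%E.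

Lemma tailE n : (m <= n)%N -> (\sum_(n <= k <oo) (f k)%:E = (tail f n)%:E)%E.
Proof.
move=> mn; rewrite /tail fineK// ge0_fin_numE.
  move: f_sum; rewrite (nneseries_split m (n - m) f_ge0) subnKC// sumEFin.
  by case: (\sum_(n <= k <oo) (f k)%:E)%E => //= r _; exact: ltry.
by apply: nneseries_ge0 => k nk _; rewrite f_ge0// (leq_trans mn).
Qed.

Lemma tail_recl n : (m <= n)%N -> tail f n = f n + tail f n.+1.
Proof.
move=> mn; apply: EFin_inj; rewrite EFinD -!tailE ?leqW//.
rewrite (nneseries_split n 1) ?addn1 ?big_nat1// => k nk.
by rewrite f_ge0// (leq_trans mn).
Qed.

Lemma tail_gt0 n : (m <= n)%N -> 0 < tail f n.
Proof.
move=> mn; rewrite tail_recl// ltr_pwDl ?f_gt0// -lee_fin -tailE ?leqW//.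
by apply: nneseries_ge0 => k nk _; rewrite f_ge0// (leq_trans mn)// ltnW.
Qed.

Lemma cvg_tail n : (m <= n)%N -> \sum_(n <= k < N) f k @[N --> \oo] --> tail f n.
Proof.
move=> mn; have := @is_cvg_nneseries R (fun k => (f k)%:E) xpredT n.
move=> /(_ (fun k nk _ => f_ge0 _ (leq_trans mn nk))).
rewrite tailE// => /fine_cvg.
apply: cvg_trans; apply: near_eq_cvg; near=> N.
by rewrite /= sumEFin.
Unshelve. all: by end_near. Qed.

End tail.

Lemma cvg_powR (R : realType) (u : nat -> R) (l p : R) : 0 < l ->
  u n @[n --> \oo] --> l -> u n `^ p @[n --> \oo] --> l `^ p.
Proof.
move=> l0; apply: (continuous_cvg _ (h := fun x => x `^ p)).
apply/differentiable_continuous/derivable1_diffP.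
by apply: derivable_powR; rewrite in_itv/= l0.
Qed.

(** * The telescoped inequality for the given weights *)

(** Only the recursion and signs of [T] up to [N] enter, so that [T] can be either the full tail of
    [lam n * a n] or a truncation of it. *)
Lemma copson_tail_partial_sum (R : realType) (lam a T : nat -> R) (p c : R) (N : nat) :
  (forall n, (1 <= n)%N -> 0 < lam n) ->
  (\sum_(1 <= n <oo) (lam n)%:E < +oo)%E ->
  (forall n, (1 <= n)%N -> 0 < a n) ->
  c < 1 -> (1 <= N)%N ->
  (forall n, (1 <= n)%N -> p * (p - 1) * tail_ratio lam n.-1 <=
     p * (p - 1) * (tail_ratio lam n * (1 - c / tail_ratio lam n) `^ (1 - p) + c)) ->
  (forall n, (1 <= n <= N)%N -> [/\ T n = lam n * a n + T n.+1, 0 <= T n.+1 &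
     0 < p \/ 0 < T n.+1]) ->
  p * (p - 1) * (\sum_(1 <= n < N.+1) (T n / tail lam n) `^ p) <=
  p * (p - 1) * ((1 - c)^-1 `^ p * (\sum_(1 <= n < N.+1) a n `^ p) +
    tail lam N.+1 / lam N * (T N.+1 / tail lam N.+1) `^ p / (1 - c)).
Proof.
move=> lam0 lam_sum a0 c1 N0 hr hT.
have ratio n : (1 <= n)%N -> tail_ratio lam n - 1 = tail lam n.+1 / lam n.
  case: n => // n _; rewrite /tail_ratio (tail_recl _ _ _ lam0 lam_sum)//.
  by rewrite mulrDl mulfV ?gt_eqF ?lam0// addrC addKr.
have Lam0 n : (1 <= n)%N -> 0 < tail lam n by exact: tail_gt0.
rewrite -ratio//; apply: (@copson_partial_sum R p c (tail_ratio lam) a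
  (fun n => T n / tail lam n)) => // n /andP[n0 nN]; last exact: hr.
have [Tn Tn1 pT] := hT n (introT andP (conj n0 nN)).
split.
- by rewrite -subr_gt0 ratio// divr_gt0 ?Lam0 ?lam0.
- exact: a0.
- by rewrite divr_ge0// ltW// Lam0.
- by case: pT => ?; [left|right; rewrite divr_gt0// Lam0].
- have := Lam0 n n0; have := Lam0 n.+1 isT; have := lam0 n n0.
  rewrite ratio// Tn; case: n n0 {nN Tn Tn1 pT} => // n _ /= l0 L10 L0.
  by field; rewrite !gt_eqF.
Qed.

(** * Passage to infinite series in the three ranges of [p] *)

Section copson_tail.
Context (R : realType) (lam a : nat -> R) (p c : R).
Hypothesis lam_gt0 : forall n, (1 <= n)%N -> 0 < lam n.
Hypothesis lam_sum : (\sum_(1 <= n <oo) (lam n)%:E < +oo)%E.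
Hypothesis a_gt0 : forall n, (1 <= n)%N -> 0 < a n.
Hypothesis c_lt1 : c < 1.

Let f n := lam n * a n.

Let f_gt0 n : (1 <= n)%N -> 0 < f n.
Proof. by move=> n0; rewrite mulr_gt0 ?lam_gt0 ?a_gt0. Qed.

Let Lam_gt0 n : (1 <= n)%N -> 0 < tail lam n.
Proof. exact: tail_gt0. Qed.

Let mean n := (\sum_(n <= k <oo) (lam k * a k / tail lam n)%:E)%E.

Let C := (1 - c)^-1 `^ p.

Let C_gt0 : 0 < C.
Proof. by rewrite powR_gt0// invr_gt0 subr_gt0. Qed.

Let epow_ge0 (x : \bar R) : (0 <= epow x p)%E.
Proof.
by case: x => [r| |] //=; [rewrite lee_fin powR_ge0|case: ifP => // _; case: ifP].
Qed.

Let meanE n : (1 <= n)%N -> (\sum_(1 <= k <oo) (f k)%:E < +oo)%E ->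
  mean n = (tail f n / tail lam n)%:E.
Proof.
move=> n0 fS; rewrite /mean nneseries_divr; last first.
  by move=> k nk; rewrite ltW// f_gt0// (leq_trans n0).
by rewrite (tailE _ _ _ f_gt0 fS)// muleC.
Qed.

Let mean_pinfty n : (1 <= n)%N -> (\sum_(1 <= k <oo) (f k)%:E = +oo)%E ->
  mean n = +oo%E.
Proof.
move=> n0 fS; rewrite /mean nneseries_divr; last first.
  by move=> k nk; rewrite ltW// f_gt0// (leq_trans n0).
by rewrite (nneseries_tail_pinfty _ _ _ f_gt0)// gt0_muley// lte_fin invr_gt0 Lam_gt0.
Qed.

Let series_dichotomy (u : nat -> R) : (forall n, (1 <= n)%N -> 0 <= u n) ->
  (\sum_(1 <= k <oo) (u k)%:E = +oo \/ \sum_(1 <= k <oo) (u k)%:E < +oo)%E.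
Proof.
move=> u0; have := @nneseries_ge0 R (fun n => (u n)%:E) xpredT 1 (fun n n0 _ => u0 n n0).
by case: (limn _) => [r| |] // _; [right; exact: ltry|left].
Qed.

Let partial_le (x : R) N : (C%:E * \sum_(1 <= n <oo) (a n `^ p)%:E = x%:E)%E ->
  C * \sum_(1 <= n < N) a n `^ p <= x.
Proof.
move=> ax; rewrite -lee_fin -ax EFinM lee_pmul2l ?lte_fin// -sumEFin.
by apply: nneseries_lim_ge => n _ _; rewrite lee_fin powR_ge0.
Qed.

Let weight_cond := forall n, (1 <= n)%N -> p * (p - 1) * tail_ratio lam n.-1 <=
  p * (p - 1) * (tail_ratio lam n * (1 - c / tail_ratio lam n) `^ (1 - p) + c).

(* It suffices to bound real partial sums: the right-hand side may be taken
   finite. *)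
Let series_le :
  (forall x, (C%:E * \sum_(1 <= n <oo) (a n `^ p)%:E = x%:E)%E ->
     forall N, (1 <= N)%N -> (\sum_(1 <= n < N) epow (mean n) p <= x%:E)%E) ->
  (\sum_(1 <= n <oo) epow (mean n) p <=
   C%:E * \sum_(1 <= n <oo) (a n `^ p)%:E)%E.
Proof.
move=> h; have := @nneseries_ge0 R (fun n => (a n `^ p)%:E) xpredT 1.
move=> /(_ (fun n _ _ => powR_ge0 _ _)).
case E : (limn _) => [r| |] // r0.
  by apply: nneseries_le => [n _|N N0]; [exact: epow_ge0|apply: h => //; rewrite E].
by rewrite gt0_muley ?lte_fin// leey.
Qed.

Lemma copson_tail_lt0 : p < 0 -> weight_cond ->
  ((tail lam n.+1 / lam n)%:E *
     epow ((\sum_(n.+1 <= k <oo) (lam k * a k)%:E) / (tail lam n.+1)%:E) p)%E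
    @[n --> \oo] --> 0%E ->
  (\sum_(1 <= n <oo) epow (mean n) p <=
   C%:E * \sum_(1 <= n <oo) (a n `^ p)%:E)%E.
Proof.
move=> p0 hr lim0; apply: series_le => x ax N N0.
have k0 : 0 < p * (p - 1) by nra.
(* If the sum of [f] diverges, all means are infinite and their negative powers are 0, so the left
   side vanishes. *)
have [fy|fS] := series_dichotomy _ (fun n n0 => ltW (f_gt0 n n0)).
  rewrite big_nat_cond big1 => [|n /andP[/andP[n0 _] _]].
    rewrite -ax mule_ge0 ?lee_fin ?(ltW C_gt0)//.
    by apply: nneseries_ge0 => n _ _; rewrite lee_fin powR_ge0.
  by rewrite mean_pinfty//= p0 ltNge (ltW p0).
pose b n := tail lam n.+1 / lam n * (tail f n.+1 / tail lam n.+1) `^ p.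
have b_cvg0 : b n @[n --> \oo] --> (0 : R).
  apply: cvg_trans (fine_cvg lim0); apply: near_eq_cvg; near=> n.
  rewrite /= (tailE _ _ _ f_gt0 fS)// inver gt_eqF ?Lam_gt0//.
under eq_big_nat => n /andP[n0 _] do rewrite meanE//=.
rewrite sumEFin lee_fin.
(* [N] stays fixed while the telescoping runs up to [M >= N]; the boundary term [b M] then
   disappears as [M] grows. *)
have bound : x + b M / (1 - c) @[M --> \oo] --> x.
  rewrite -[in X in _ --> X](addr0 x) -[in X in _ --> X](mul0r (1 - c)^-1).
  by apply: cvgD; [exact: cvg_cst|apply: cvgM => //; exact: cvg_cst].
apply: cvgr_to_ge bound _; near=> M.
have NM : (N <= M)%N by near: M; exact: nbhs_infty_ge.
have M0 : (1 <= M)%N by exact: leq_trans NM.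
have := copson_tail_partial_sum _ _ _ (tail f) _ _ _ lam_gt0 lam_sum a_gt0 c_lt1 M0 hr.
move=> /(_ _)/[!(ler_pM2l k0)] h.
apply: (@le_trans _ _ (\sum_(1 <= n < M.+1) (tail f n / tail lam n) `^ p)).
  rewrite (big_cat_nat N0 (leqW NM))/= lerDl sumr_ge0// => n _.
  exact: powR_ge0.
apply: (le_trans (h _)); last by rewrite lerD2r partial_le.
move=> n /andP[n0 _]; split.
- exact: (tail_recl _ _ _ f_gt0 fS).
- by rewrite ltW// (tail_gt0 _ _ _ f_gt0 fS).
- by right; rewrite (tail_gt0 _ _ _ f_gt0 fS).
Unshelve. all: by end_near. Qed.

(** Truncation gives a bound uniform in the cut-off [M]. It first yields summability of [f], then
    the claim as [M] tends to infinity. *)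
Lemma copson_tail_gt1 : 1 < p -> weight_cond ->
  (\sum_(1 <= n <oo) epow (mean n) p <=
   C%:E * \sum_(1 <= n <oo) (a n `^ p)%:E)%E.
Proof.
move=> p1 hr; apply: series_le => x ax N N0.
have p0 : 0 < p by lra.
have k0 : 0 < p * (p - 1) by nra.
pose T M n := \sum_(n <= k < M.+1) f k.
have T_ge0 M n : (1 <= n)%N -> 0 <= T M n.
  move=> n0; rewrite /T big_nat sumr_ge0// => k /andP[nk _].
  by rewrite ltW// f_gt0// (leq_trans n0).
have truncated M : (1 <= M)%N ->
    \sum_(1 <= n < M.+1) (T M n / tail lam n) `^ p <= x.
  move=> M0.
  have := copson_tail_partial_sum _ _ _ (T M) _ _ _ lam_gt0 lam_sum a_gt0 c_lt1 M0 hr.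
  (* The boundary term contains an empty sum raised to a positive power. *)
  have TM0 : T M M.+1 = 0 by rewrite /T big_geq.
  rewrite TM0 mul0r powR0 ?gt_eqF// mulr0 mul0r addr0.
  move=> /(_ _)/[!(ler_pM2l k0)] h.
  apply: (le_trans (h _)); last exact: partial_le.
  move=> n /andP[n0 nM]; split; [|exact: T_ge0|by left].
  by rewrite /T big_ltn.
have x0 : 0 <= x by apply: le_trans (truncated 1%N isT); rewrite sumr_ge0// => n _; exact: powR_ge0.
have fS : (\sum_(1 <= k <oo) (f k)%:E < +oo)%E.
  (* The summand [n = 1] of the truncated bound alone controls the partial sums of [f]; taking
     [p]-th roots gives this constant. *)
  apply: (@le_lt_trans _ _ (x `^ p^-1 * tail lam 1)%:E); last exact: ltry.
  apply: nneseries_le => [k k1|[//|M] _]; first by rewrite lee_fin ltW// f_gt0.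
  have [->|M0] := posnP M.
    by rewrite big_geq// lee_fin mulr_ge0 ?powR_ge0// ltW// Lam_gt0.
  have T0 : 0 <= T M 1%N / tail lam 1 by rewrite divr_ge0 ?T_ge0// ltW// Lam_gt0.
  rewrite sumEFin lee_fin -/(T M 1%N) -ler_pdivrMr ?Lam_gt0//.
  rewrite -[leLHS](powRr1 T0) -(mulfV (lt0r_neq0 p0)) powRrM.
  rewrite ge0_ler_powR ?nnegrE ?powR_ge0 ?invr_ge0 ?(ltW p0)//.
  apply: le_trans (truncated M M0); rewrite big_ltn// lerDl sumr_ge0// => n _.
  exact: powR_ge0.
under eq_big_nat => n /andP[n0 _] do rewrite meanE//=.
rewrite sumEFin lee_fin.
have lim : \sum_(1 <= n < N) (T M n / tail lam n) `^ p @[M --> \oo] -->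
    \sum_(1 <= n < N) (tail f n / tail lam n) `^ p.
  rewrite [in X in _ --> X]big_nat.
  under eq_fun do rewrite big_nat.
  apply: (cvg_big add_continuous) => n /andP[n0 _].
  apply: cvg_powR; first by rewrite divr_gt0 ?Lam_gt0// (tail_gt0 _ _ _ f_gt0 fS).
  apply: cvgM; last exact: cvg_cst.
  have := cvg_tail _ _ _ f_gt0 fS n n0.
  by rewrite -cvg_shiftS.
apply: cvgr_to_le lim _; near=> M.
have NM : (N <= M)%N by near: M; exact: nbhs_infty_ge.
apply: le_trans (truncated M (leq_trans N0 NM)).
rewrite (big_cat_nat N0 (leqW NM))/= lerDl sumr_ge0// => n _.
exact: powR_ge0.
Unshelve. all: by end_near. Qed.

Lemma copson_tail_lt1 : 0 < p < 1 -> weight_cond ->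
  (C%:E * \sum_(1 <= n <oo) (a n `^ p)%:E <=
   \sum_(1 <= n <oo) epow (mean n) p)%E.
Proof.
move=> /andP[p0 p1] hr.
have k0 : p * (p - 1) < 0 by nra.
have partial_mean_le N : (\sum_(1 <= n < N) epow (mean n) p <=
    \sum_(1 <= n <oo) epow (mean n) p)%E.
  by apply: nneseries_lim_ge => n _ _; exact: epow_ge0.
have [fy|fS] := series_dichotomy _ (fun n n0 => ltW (f_gt0 n n0)).
  (* In the divergent case the first mean is already infinite, and so is its positive power. *)
  apply: le_trans (partial_mean_le 2%N).
  by rewrite big_nat1 mean_pinfty//= p0 leey.
(* Dividing by [C > 0] isolates the series of powers of [a], which is then bounded through its
   partial sums. *)
rewrite muleC -lee_pdivlMr//; apply: nneseries_le => [n _|N N0].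
  by rewrite lee_fin powR_ge0.
rewrite lee_pdivlMr// muleC; apply: le_trans (partial_mean_le N).
under [leRHS]eq_big_nat => n /andP[n0 _] do rewrite meanE//=.
rewrite !sumEFin -EFinM lee_fin.
case: N N0 => // N _; have [->|N0] := posnP N.
  by rewrite !big_geq// mulr0.
have := copson_tail_partial_sum _ _ _ (tail f) _ _ _ lam_gt0 lam_sum a_gt0 c_lt1 N0 hr.
move=> /(_ _)/[!(ler_nM2l k0)] h.
apply: le_trans (h _); last first.
  move=> n /andP[n0 _]; split.
  - exact: (tail_recl _ _ _ f_gt0 fS).
  - by rewrite ltW// (tail_gt0 _ _ _ f_gt0 fS).
  - by left.
rewrite lerDl divr_ge0 ?subr_ge0 ?(ltW c_lt1)// mulr_ge0 ?powR_ge0//.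
by rewrite divr_ge0 ?(ltW (Lam_gt0 _ _)) ?(ltW (lam_gt0 _ _)).
Qed.

End copson_tail.

(** * Translation of the parameters to [c = L / p] *)

Theorem theorem6p1 (R : realType) (lam a : nat -> R) (p L : R)
  (lam_gt0 : forall n : nat, (1 <= n)%N -> 0 < lam n)
  (lam_sum : (\sum_(1 <= n <oo) (lam n)%:E < +oo)%E)
  (p_neq0 : p != 0)
  (a_gt0 : forall n : nat, (1 <= n)%N -> 0 < a n)
  (L_lt : 0 < p -> L < p)
  (L_gt : p < 0 -> p < L)
  (lim0 : p < 0 ->
    ((tail lam n.+1 / lam n)%:E *
       epow ((\sum_(n.+1 <= k <oo) (lam k * a k)%:E) / (tail lam n.+1)%:E) p)%E
      @[n --> \oo] --> 0%E) :
  (1 < p \/ p < 0 ->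
   (forall n : nat, (1 <= n)%N ->
      tail_ratio lam n.-1 <=
      tail_ratio lam n * (1 - L * lam n / (p * tail lam n)) `^ (1 - p)
      + L / p) ->
   (\sum_(1 <= n <oo) epow (\sum_(n <= k <oo) (lam k * a k / tail lam n)%:E) p
    <= ((p / (p - L)) `^ p)%:E * \sum_(1 <= n <oo) (a n `^ p)%:E)%E)
  /\
  (0 < p < 1 ->
   (forall n : nat, (1 <= n)%N ->
      tail_ratio lam n * (1 - L * lam n / (p * tail lam n)) `^ (1 - p)
      + L / p
      <= tail_ratio lam n.-1) ->
   (((p / (p - L)) `^ p)%:E * \sum_(1 <= n <oo) (a n `^ p)%:E
    <= \sum_(1 <= n <oo)
         epow (\sum_(n <= k <oo) (lam k * a k / tail lam n)%:E) p)%E).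

Proof.
set c := L / p.
have pL0 : p - L != 0.
  rewrite subr_eq0; case: (ltgtP p 0) p_neq0 => // [/L_gt|/L_lt]; first by move/lt_eqF->.
  by move/gt_eqF->.
(* Division by a negative [p] reverses [p < L], so both sign cases give the same bound. *)
have c_lt1 : c < 1.
  case: (ltgtP p 0) p_neq0 => // p0 _; rewrite /c.
    by rewrite ltr_ndivrMr// mul1r L_gt.
  by rewrite ltr_pdivrMr// mul1r L_lt.
have constE : p / (p - L) = (1 - c)^-1.
  have -> : 1 - c = (p - L) / p by rewrite mulrBl mulfV.
  by rewrite invf_div.
have argE n : (1 <= n)%N ->
    1 - L * lam n / (p * tail lam n) = 1 - c / tail_ratio lam n.
  case: n => // n _; rewrite /c /tail_ratio invf_div.
  by rewrite mulf_div.
rewrite constE; split=> [p_cvx|p_ccv] hr.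
(* The sign of [p * (p - 1)] merges the two opposite weight conditions into one. *)
- have k0 : 0 < p * (p - 1) by case: p_cvx => ?; nra.
  have {}hr n : (1 <= n)%N -> p * (p - 1) * tail_ratio lam n.-1 <= p * (p - 1) *
      (tail_ratio lam n * (1 - c / tail_ratio lam n) `^ (1 - p) + c).
    by move=> n0; rewrite ler_pM2l// -argE// hr.
  case: p_cvx => p0; first exact: copson_tail_gt1.
  by apply: copson_tail_lt0 => //; exact: lim0.
- have k0 : p * (p - 1) < 0 by case/andP: p_ccv => ? ?; nra.
  apply: copson_tail_lt1 => // n n0.
  by rewrite ler_nM2l// -argE// hr.
Qed.
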